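(* Let $P=\{x\in\mathbb{R}^d : Ax\leqslant b\}$ be a polytope with $\dim(P)\geqslant 1$, where $A\in\mathbb{R}^{m\times d}$, $b\in\mathbb{R}^m$. Then the extension complexity of $P$ equals the minimum size of a slack generating set of $P$ with respect to $Ax\leqslant b$. (In particular this minimum is the same for every system $Ax\leqslant b$ defining $P$.)
   Context: The slack map of $P$ w.r.t.\ $Ax\leqslant b$ is the affine map $\sigma:\mathbb{R}^d\to\mathbb{R}^m$, $\sigma(x)=b-Ax$, and $\tilde P:=\sigma(P)$ is the slack representation. A slack generating set of $P$ w.r.t.\ $Ax\leqslant b$ of size $r$ is a set $\{t_1,\dots,t_r\}\subseteq\mathbb{R}^m_{+}$ of nonnegative vectors such that every point of $\tilde P$ is a nonnegative combination of $t_1,\dots,t_r$. An extension of $P$ is a polytope $Q\subseteq\mathbb{R}^e$ together with an affine map $\pi:\mathbb{R}^e\to\mathbb{R}^d$ with $\pi(Q)=P$; the extension complexity $\mathrm{xc}(P)$ is the minimum number of facets of an extension of $P$. *)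

(* Defs.v *)
From mathcomp Require Import all_boot all_order all_algebra.
From mathcomp Require Import finmap.
From mathcomp Require Import classical_sets cardinality reals.

Set Implicit Arguments.
Unset Strict Implicit.
Unset Printing Implicit Defensive.

Import Order.TTheory GRing.Theory Num.Theory.

Local Open Scope classical_set_scope.
Local Open Scope card_scope.
Local Open Scope ring_scope.

Definition is_minimum (S : set nat) (n : nat) : Prop := S n /\ lbound S n.

Section Polyhedra.
Variable R : realType.

Definition polyhedron d m (A : 'M[R]_(m, d)) (b : 'cV[R]_m) : set 'cV[R]_d :=
  [set x | forall i, (A *m x) i 0 <= b i 0].

(* Boundedness is spelled out coordinatewise so that dimension 0 is covered. *)
Definition bounded_cV d (S : set 'cV[R]_d) : Prop :=
  exists B : R, forall x, S x -> forall i, `|x i 0| <= B.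

Definition is_polytope d (S : set 'cV[R]_d) : Prop :=
  (exists m (A : 'M[R]_(m, d)) (b : 'cV[R]_m), S = polyhedron A b)
  /\ bounded_cV S.

Definition aff_hull d (S : set 'cV[R]_d) : set 'cV[R]_d :=
  [set x | exists n (p : 'I_n -> 'cV[R]_d) (l : 'I_n -> R),
     [/\ forall i, S (p i), \sum_(i < n) l i = 1
       & x = \sum_(i < n) l i *: p i]].

(* [has_dim S k] : the affine hull of [S] is a translate of a k-dimensional
   linear subspace.  No [k] satisfies this when [S] is empty. *)
Definition has_dim d (S : set 'cV[R]_d) (k : nat) : Prop :=
  exists (x0 : 'cV[R]_d) (U : {vspace 'cV[R]_d}),
    \dim U = k /\ aff_hull S = [set x | x - x0 \in U].

Definition is_face d (Q F : set 'cV[R]_d) : Prop :=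
  exists (c : 'rV[R]_d) (delta : R),
    (forall x, Q x -> (c *m x) 0 0 <= delta)
    /\ F = [set x | Q x /\ (c *m x) 0 0 = delta].

(* Codimension-one faces.  As [has_dim] does not see the empty set, a single
   point has no facet here. *)
Definition is_facet d (Q F : set 'cV[R]_d) : Prop :=
  is_face Q F /\ exists k, has_dim Q k.+1 /\ has_dim F k.

Definition facets d (Q : set 'cV[R]_d) : set (set 'cV[R]_d) :=
  [set F | is_facet Q F].

Definition is_affine e d (f : 'cV[R]_e -> 'cV[R]_d) : Prop :=
  exists (M : 'M[R]_(d, e)) (c : 'cV[R]_d), forall y, f y = M *m y + c.

Definition is_extension d (P : set 'cV[R]_d) e (Q : set 'cV[R]_e)
    (f : 'cV[R]_e -> 'cV[R]_d) : Prop :=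
  [/\ is_polytope Q, is_affine f & f @` Q = P].

Definition extension_sizes d (P : set 'cV[R]_d) : set nat :=
  [set n | exists e (Q : set 'cV[R]_e) (f : 'cV[R]_e -> 'cV[R]_d),
     is_extension P Q f /\ facets Q #= `I_n].

Definition is_xc d (P : set 'cV[R]_d) (n : nat) : Prop :=
  is_minimum (extension_sizes P) n.

Definition slack_map d m (A : 'M[R]_(m, d)) (b : 'cV[R]_m) (x : 'cV[R]_d) :
  'cV[R]_m := b - A *m x.

Definition slack_rep d m (A : 'M[R]_(m, d)) (b : 'cV[R]_m) : set 'cV[R]_m :=
  slack_map A b @` polyhedron A b.

Definition is_slack_generating_set d m (A : 'M[R]_(m, d)) (b : 'cV[R]_m)
    (T : {fset 'cV[R]_m}) : Prop :=
  (forall t, t \in T -> forall i, 0 <= t i 0)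
  /\ forall s, slack_rep A b s ->
       exists l : 'cV[R]_m -> R,
         (forall t, t \in T -> 0 <= l t) /\ s = \sum_(t <- T) l t *: t.

Definition slack_generating_set_sizes d m (A : 'M[R]_(m, d)) (b : 'cV[R]_m) :
    set nat :=
  [set r | exists T : {fset 'cV[R]_m},
     is_slack_generating_set A b T /\ #|` T|%fset = r].

Definition is_min_slack_size d m (A : 'M[R]_(m, d)) (b : 'cV[R]_m) (r : nat) :
    Prop :=
  is_minimum (slack_generating_set_sizes A b) r.

End Polyhedra.

(* Main.v *)
Require Import Defs.
From mathcomp Require Import all_boot all_order all_algebra.
From mathcomp Require Import finmap.
From mathcomp Require Import boolp classical_sets functions cardinality reals.
From mathcomp Require Import ring lra.

(* A slack generating set t_1, ..., t_r without zero vectors gives the extension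
   {(x, l) | b - A x = sum_k l_k t_k, l >= 0}, which is bounded and has at most
   r facets, since each facet is cut out by one of the inequalities l_k >= 0.
   Conversely, let Q be an extension and choose a minimal set J of its
   inequalities such that, on the affine hull of Q, every affine form that is
   nonnegative on Q is a nonnegative combination of slacks in J plus a constant.
   By minimality and Farkas' lemma the rows in J define pairwise distinct
   facets, and since Q is bounded and is not a point, the constant 1 is itself a
   nonnegative combination of slacks in J.  Expressing the slacks of P composed
   with the projection in terms of those in J, the coefficient vectors form a
   slack generating set with at most as many elements as Q has facets. *)

Set Implicit Arguments.
Unset Strict Implicit.
Unset Printing Implicit Defensive.

Import Order.TTheory GRing.Theory Num.Theory.

Local Open Scope classical_set_scope.
Local Open Scope ring_scope.

Section Farkas.
Variable R : realType.

(* Bartl's induction on the number of functionals: if the last functional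
   [a i0] is needed, some [xb] has [c xb < 0 <= a i xb] for the others, and the
   projection [x |-> x + k x *: xb] onto the kernel of [a i0] reduces to them. *)
Lemma farkas (E : lmodType R) (V : set E) (I : eqType) (s : seq I)
    (a : I -> E -> R) (c : E -> R) :
  (forall t x y, V x -> V y -> V (x + t *: y)) ->
  (forall i t x y, a i (x + t *: y) = a i x + t * a i y) ->
  (forall t x y, c (x + t *: y) = c x + t * c y) ->
  uniq s ->
  (forall x, V x -> (forall i, i \in s -> 0 <= a i x) -> 0 <= c x) ->
  exists al : I -> R, (forall i, 0 <= al i) /\
    forall x, V x -> c x = \sum_(i <- s) al i * a i x.
Proof.
move=> VL; elim: s a c => [|i0 s IHs] a c aL cL.
  move=> _ c_ge0; exists (fun=> 0); split=> // x Vx; rewrite big_nil.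
  have := c_ge0 x Vx; have := c_ge0 _ (VL (-2) _ _ Vx Vx).
  rewrite cL => h1 h2; have := h1 (fun i => ltac:(by [])).
  have := h2 (fun i => ltac:(by [])); lra.
move=> /= /andP[i0s uniqs] c_ge0.
have [cs|/existsNP[xb /not_implyP[Vxb /not_implyP[axb /negP]]]] :=
  pselect (forall x, V x -> (forall i, i \in s -> 0 <= a i x) -> 0 <= c x).
  have [al [al_ge0 calE]] := IHs a c aL cL uniqs cs.
  exists (fun i => if i == i0 then 0 else al i); split=> [i|x Vx].
    by case: ifP.
  rewrite big_cons eqxx mul0r add0r calE//.
  by apply: eq_big_seq => i si; case: eqP => // ii0; rewrite -ii0 si in i0s.
rewrite -ltNge => cxb.
have w0 : a i0 xb < 0.
  rewrite ltNge; apply/negP => w0; move: cxb; rewrite ltNge => /negP; apply.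
  by apply: c_ge0 => // i; rewrite inE => /predU1P[->|/axb].
set w := a i0 xb in w0.
have wn0 : w != 0 by rewrite lt_eqF.
pose k x := - (a i0 x / w).
have [|||al [al_ge0 calE]] :=
  IHs (fun i x => a i (x + k x *: xb)) (fun x => c (x + k x *: xb)) _ _ uniqs.
- by move=> i t x y; rewrite !aL /k aL; field.
- by move=> t x y; rewrite !cL /k aL; field.
- move=> x Vx ax; apply: c_ge0; first exact: VL.
  move=> i; rewrite inE => /predU1P[->|/ax//].
  by rewrite aL /k -/w mulNr divfK// subrr.
pose S := \sum_(i <- s) al i * a i xb.
have S0 : 0 <= S.
  by rewrite /S big_seq sumr_ge0// => i si; rewrite mulr_ge0// axb.
exists (fun i => if i == i0 then (c xb - S) / w else al i); split=> [i|x Vx].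
  case: ifP => // _; rewrite -[X in X / _]opprK mulNr -mulrN -invrN.
  by rewrite divr_ge0//; lra.
rewrite big_cons eqxx.
have -> : \sum_(i <- s) (if i == i0 then (c xb - S) / w else al i) * a i x =
    \sum_(i <- s) al i * a i x.
  by apply: eq_big_seq => i si; case: eqP => // ii0; rewrite -ii0 si in i0s.
have := calE x Vx; rewrite cL.
under eq_bigr do rewrite aL mulrDr mulrCA.
rewrite big_split/= -mulr_sumr -/S => /eqP.
rewrite -subr_eq => /eqP <-; rewrite /k; field; exact: wn0.
Qed.

End Farkas.

Section AffineForms.
Variables (R : realType) (e : nat).
Implicit Types (h g : 'cV[R]_e -> R) (x y u : 'cV[R]_e) (U : {vspace 'cV[R]_e}).

Definition affine_form h :=
  exists (a : 'rV[R]_e) (dl : R), forall x, h x = dl - (a *m x) 0 0.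

Lemma affine_form_sum h n (p : 'I_n -> 'cV[R]_e) (l : 'I_n -> R) :
  affine_form h -> \sum_i l i = 1 ->
  h (\sum_i l i *: p i) = \sum_i l i * h (p i).
Proof.
move=> [a [dl hE]] l1; rewrite hE mulmx_sumr summxE.
under [RHS]eq_bigr do rewrite hE mulrBr.
rewrite sumrB -mulr_suml l1 mul1r; congr (_ - _).
by apply: eq_bigr => i _; rewrite -scalemxAr mxE.
Qed.

Lemma affine_form_scale h x u t :
  affine_form h -> h (x + t *: u) = h x + t * (h u - h 0).
Proof.
by move=> [a [dl hE]]; rewrite !hE mulmxDr -scalemxAr mulmx0 !mxE; ring.
Qed.

Lemma affine_form_sub h x y : affine_form h -> h (y - x) - h 0 = h y - h x.
Proof.
by move=> [a [dl hE]]; rewrite !hE mulmxBr mulmx0 !mxE; ring.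
Qed.

Lemma affine_form_line h x y t :
  affine_form h -> h (x + t *: (y - x)) = h x + t * (h y - h x).
Proof. by move=> ah; rewrite affine_form_scale// affine_form_sub. Qed.

Definition homogenize h (v : 'cV[R]_e * R^o) : R := h v.1 - h 0 + v.2 * h 0.

Lemma homogenize_linear h t (v w : 'cV[R]_e * R^o) : affine_form h ->
  homogenize h (v + t *: w) = homogenize h v + t * homogenize h w.
Proof.
move=> ah; rewrite /homogenize /= affine_form_scale//.
by rewrite -[t *: w.2]/(t * w.2); ring.
Qed.

Lemma homogenize_pos h x (t : R) : affine_form h -> t != 0 ->
  homogenize h (x, t) = t * h (t^-1 *: x).
Proof.
move=> ah t0; rewrite /homogenize/= -[t^-1 *: x]add0r affine_form_scale//.
by field.
Qed.

Let cone (x0 : 'cV[R]_e) U : set ('cV[R]_e * R^o) :=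
  [set v | v.1 - v.2 *: x0 \in U].

Lemma homogenize_cone x0 U t v w :
  cone x0 U v -> cone x0 U w -> cone x0 U (v + t *: w).
Proof.
rewrite /cone/= => vU wU; rewrite scalerDl -[t *: w.2]/(t * w.2) -scalerA.
by rewrite opprD addrACA -scalerBr rpredD// rpredZ.
Qed.

Lemma cone1 x0 U x : x - x0 \in U -> cone x0 U (x, 1).
Proof. by rewrite /cone/= scale1r. Qed.

Lemma cone_pos x0 U x (t : R) : t != 0 -> cone x0 U (x, t) -> t^-1 *: x - x0 \in U.
Proof.
rewrite /cone/= => t0 /(rpredZ t^-1).
by rewrite scalerBr scalerA mulVf// scale1r.
Qed.

Lemma homogenize1 h x : homogenize h (x, 1) = h x.
Proof. by rewrite /homogenize/=; ring. Qed.

Lemma affine_farkas_infeasible x0 U (I : eqType) (s : seq I)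
    (h : I -> 'cV[R]_e -> R) :
  (forall i, affine_form (h i)) -> uniq s ->
  (forall x, x - x0 \in U -> ~ (forall i, i \in s -> 0 <= h i x)) ->
  exists al : I -> R, (forall i, 0 <= al i) /\
    forall x, x - x0 \in U -> -1 = \sum_(i <- s) al i * h i x.
Proof.
move=> ah us inf.
have [|||al [al0 alE]] := @farkas R ('cV[R]_e * R^o)%type (cone x0 U) _ s
    (fun i => homogenize (h i)) (fun v => - v.2) (@homogenize_cone x0 U) _ _ us.
- by move=> i t v w; rewrite homogenize_linear.
- by move=> t v w /=; rewrite -[t *: w.2]/(t * w.2); ring.
- move=> [x t] Vx hx; rewrite /= oppr_ge0 leNgt; apply/negP => t0.
  have tn0 : t != 0 by rewrite gt_eqF.
  apply: (inf (t^-1 *: x)); first exact: cone_pos.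
  by move=> i /hx; rewrite homogenize_pos// pmulr_rge0.
exists al; split => // x xU; have := alE _ (cone1 xU).
by under eq_bigr do rewrite homogenize1.
Qed.

Lemma affine_farkas x0 U (I : eqType) (s : seq I) (h : I -> 'cV[R]_e -> R) g :
  (forall i, affine_form (h i)) -> affine_form g -> uniq s ->
  (exists x, x - x0 \in U /\ forall i, i \in s -> 0 <= h i x) ->
  (forall x, x - x0 \in U -> (forall i, i \in s -> 0 <= h i x) -> 0 <= g x) ->
  exists (al : I -> R) (be : R), [/\ forall i, 0 <= al i, 0 <= be &
    forall x, x - x0 \in U -> g x = \sum_(i <- s) al i * h i x + be].
Proof.
move=> ah ag us [x1 [x1U hx1]] hg.
pose a o v := if o is Some i then homogenize (h i) v else v.2 : R.
have [||||al [al0 alE]] := @farkas R ('cV[R]_e * R^o)%type (cone x0 U) _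
    (None :: map Some s) a (homogenize g) (@homogenize_cone x0 U) _ _ _.
- by move=> [i|] t v w; rewrite /a// homogenize_linear.
- by move=> t v w /=; rewrite homogenize_linear.
- rewrite /= map_inj_uniq ?us ?andbT; last by move=> ? ? [].
  by apply/mapP => -[].
- move=> [x t] Vx hx; have := hx None (mem_head _ _); rewrite /a/=.
  have {}hx i : i \in s -> 0 <= homogenize (h i) (x, t).
    by move=> si; have := hx (Some i); rewrite inE /= map_f//; apply.
  rewrite le0r => /predU1P[t0|t0].
    move: Vx; rewrite t0 /cone/= scale0r subr0 => xU.
    rewrite {}t0 in hx *.
    have xE k : affine_form k -> homogenize k (x, 0) = k x - k 0.
      by move=> _; rewrite /homogenize /=; ring.
    rewrite xE// leNgt; apply/negP => gx.
    have g1 : 0 <= g x1 by apply: hg.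
    pose r := (g x1 + 1) / - (g x - g 0).
    have r0 : 0 <= r by rewrite divr_ge0 ?oppr_ge0 ?ltW//; lra.
    have : 0 <= g (x1 + r *: x).
      apply: hg => [|i si].
        by rewrite addrAC rpredD// rpredZ.
      rewrite affine_form_scale// addr_ge0 ?hx1// mulr_ge0//.
      by rewrite -xE// hx.
    rewrite affine_form_scale// /r.
    have -> : (g x1 + 1) / - (g x - g 0) * (g x - g 0) = - (g x1 + 1).
      by field; move: gx; case: eqP => //; lra.
    lra.
  have tn0 : t != 0 by rewrite gt_eqF.
  rewrite homogenize_pos// pmulr_rge0//.
  apply: hg; first exact: cone_pos.
  by move=> i /hx; rewrite homogenize_pos// pmulr_rge0.
exists (al \o Some), (al None); split=> [i||x xU] //=.
have := alE _ (cone1 xU); rewrite homogenize1 big_cons big_map /= mulr1 addrC.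
by under eq_bigr do rewrite homogenize1.
Qed.

Lemma aff_hull_cons (S : set 'cV[R]_e) y p q t :
  aff_hull S y -> S p -> S q -> aff_hull S (y + t *: (p - q)).
Proof.
move=> [n [z [l [Sz l1 ->]]]] Sp Sq.
pose f2 T (a b : T) (f : 'I_n -> T) (i : 'I_n.+2) :=
  if unlift ord0 i is Some j then
    if unlift ord0 j is Some k then f k else b else a.
exists n.+2, (f2 _ p q z), (f2 _ t (- t) l); split.
- by move=> i; rewrite /f2; case: unliftP => // j _; case: unliftP.
- rewrite !big_ord_recl /f2 unlift_none liftK unlift_none addrA subrr add0r.
  by rewrite -l1; apply: eq_bigr => i _; rewrite !liftK.
- rewrite !big_ord_recl /f2 unlift_none liftK unlift_none.
  rewrite addrA [LHS]addrC scalerBr scaleNr; congr (_ + _).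
  by apply: eq_bigr => i _; rewrite !liftK.
Qed.

Lemma sub_aff_hull (S : set 'cV[R]_e) : S `<=` aff_hull S.
Proof.
move=> x Sx; exists 1, (fun=> x), (fun=> 1); split=> //.
  by rewrite big_ord1.
by rewrite big_ord1 scale1r.
Qed.

Lemma affine_form_aff_hull (S : set 'cV[R]_e) h t : affine_form h ->
  (forall x, S x -> h x = t) -> forall x, aff_hull S x -> h x = t.
Proof.
move=> ah hS _ [n [z [l [Sz l1 ->]]]]; rewrite affine_form_sum//.
by under eq_bigr do rewrite hS//; rewrite -mulr_suml l1 mul1r.
Qed.

(* [U] is taken of maximal dimension among the subspaces [U] such that [x0 + U]
   lies in the affine hull. *)
Lemma aff_hull_vspace (S : set 'cV[R]_e) x0 : S x0 ->
  exists U : {vspace 'cV[R]_e}, aff_hull S = [set x | x - x0 \in U].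
Proof.
move=> Sx0.
pose G n := `[< exists U, \dim U = n /\
  forall u, u \in U -> aff_hull S (x0 + u) >].
have G0 : exists n, G n.
  exists 0; apply/asboolP; exists 0%VS; rewrite dimv0; split=> // u.
  by rewrite memv0 => /eqP ->; rewrite addr0; apply: sub_aff_hull.
have Gle n : G n -> (n <= \dim {:'cV[R]_e})%N.
  by move=> /asboolP[U [<- _]]; apply/dimvS/subvf.
case: (ex_maxnP G0 Gle) => n /asboolP[U [Un HU]] maxn.
have SU x : S x -> x - x0 \in U.
  move=> Sx; apply: contrapT => /negP xU.
  have /maxn : G (\dim (U + <[x - x0]>)%VS).
    apply/asboolP; eexists; split; first reflexivity.
    move=> _ /memv_addP[u uU [_ /vlineP[k ->] ->]].
    by rewrite addrA; apply: aff_hull_cons => //; apply: HU.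
  rewrite -Un leqNgt => /negP; apply.
  rewrite ltn_neqAle dimvS ?addvSl// andbT; apply: contra xU => /eqP dimE.
  have /eqP -> : U == (U + <[x - x0]>)%VS by rewrite eqEdim addvSl dimE/=.
  by apply: (subvP (addvSr _ _)); apply: memv_line.
exists U; apply/seteqP; split=> x /=.
  move=> [m [z [l [Sz l1 ->]]]].
  have -> : x0 = \sum_(i < m) l i *: x0 by rewrite -scaler_suml l1 scale1r.
  rewrite -sumrB rpred_sum// => i _.
  by rewrite -scalerBr rpredZ// SU.
by move=> /HU; rewrite addrC subrK.
Qed.

End AffineForms.

Section Polyhedron.
Variables (R : realType) (e m : nat) (A : 'M[R]_(m, e)) (b : 'cV[R]_m).
Implicit Types (x y z u : 'cV[R]_e) (F : set 'cV[R]_e).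

Local Notation Q := (polyhedron A b).
Local Notation h i := (fun x : 'cV[R]_e => slack_map A b x i 0).

Lemma slack_mapE x i : slack_map A b x i 0 = b i 0 - (A *m x) i 0.
Proof. by rewrite /slack_map mxE [X in _ + X]mxE. Qed.

Lemma affine_form_slack i : affine_form (h i).
Proof.
by exists (row i A), (b i 0) => x; rewrite slack_mapE -row_mul [in RHS]mxE.
Qed.

Lemma polyhedronP x : Q x <-> forall i, 0 <= slack_map A b x i 0.
Proof.
by split=> Qx i; have := Qx i; rewrite slack_mapE subr_ge0.
Qed.

Lemma polyhedron_midpoint x y : Q x -> Q y -> Q (x + 2^-1 *: (y - x)).
Proof.
move=> /polyhedronP Qx /polyhedronP Qy; apply/polyhedronP => i.
rewrite (affine_form_line _ _ _ (affine_form_slack i)).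
by have := Qx i; have := Qy i; lra.
Qed.

Lemma exists_common_positive (S : set 'cV[R]_e) (I : eqType) (s : seq I)
    (g : I -> 'cV[R]_e -> R) :
  (forall i, affine_form (g i)) -> S !=set0 ->
  (forall x y, S x -> S y -> S (x + 2^-1 *: (y - x))) ->
  (forall i x, i \in s -> S x -> 0 <= g i x) ->
  (forall i, i \in s -> exists x, S x /\ 0 < g i x) ->
  exists x, S x /\ forall i, i \in s -> 0 < g i x.
Proof.
move=> ag [x0 Sx0] mid; elim: s => [|i s IHs] g0 gp; first by exists x0.
have [||x [Sx gx]] := IHs.
- by move=> j x js; apply: g0; rewrite inE js orbT.
- by move=> j js; apply: gp; rewrite inE js orbT.
have [y [Sy gy]] := gp i (mem_head _ _).
exists (x + 2^-1 *: (y - x)); split=> [|j js]; first exact: mid.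
rewrite affine_form_line//.
have := g0 _ _ js Sx; have := g0 _ _ js Sy.
by move: js; rewrite inE => /predU1P[->|/gx]; [have := gy|]; lra.
Qed.

Lemma exists_small_step (I : eqType) (s : seq I) (f g : I -> R) :
  (forall i, i \in s -> 0 < f i) ->
  exists eps, 0 < eps /\ forall i, i \in s -> 0 <= f i + eps * g i.
Proof.
move=> f0; suff [eps [eps0 H]] : exists eps, 0 < eps /\
    forall t i, 0 <= t <= eps -> i \in s -> 0 <= f i + t * g i.
  by exists eps; split=> // i; apply: H; rewrite lexx ltW.
elim: s f0 => [|i s IHs] f0; first by exists 1; split.
have [j js|eps [eps0 H]] := IHs; first by apply: f0; rewrite inE js orbT.
have fi := f0 i (mem_head _ _).
have gi : 0 < 1 + `|g i| by rewrite ltr_pwDl.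
exists (Num.min eps (f i / (1 + `|g i|))); split.
  by rewrite lt_min eps0 divr_gt0.
move=> t j /andP[t0]; rewrite le_min => /andP[teps tf].
rewrite inE => /predU1P[->|js]; last by apply: H; rewrite ?t0.
move: tf; rewrite ler_pdivlMr// => tf.
have := ler_norm (- g i); rewrite normrN => gn.
have := ler_wpM2l t0 gn; nra.
Qed.

Lemma aff_hull_nonempty F x : aff_hull F x -> F !=set0.
Proof.
move=> [[|n] [p [l [Fp l1 _]]]]; last by exists (p ord0).
by move: l1; rewrite big_ord0 => /eqP; rewrite eq_sym oner_eq0.
Qed.

Lemma aff_hull_mono (S T : set 'cV[R]_e) : S `<=` T -> aff_hull S `<=` aff_hull T.
Proof.
by move=> ST x [n [p [l [Sp l1 ->]]]]; exists n, p, l; split=> // i; apply: ST.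
Qed.

Lemma direction_sub (U W : {vspace 'cV[R]_e}) x0 x1 :
  [set x | x - x1 \in W] `<=` [set x | x - x0 \in U] -> (W <= U)%VS.
Proof.
move=> WU; apply/subvP => w wW.
have h1 : x1 - x0 \in U by apply: (WU x1); rewrite /= subrr mem0v.
have h2 : x1 + w - x0 \in U by apply: (WU (x1 + w)); rewrite /= addrC addKr.
have -> : w = (x1 + w - x0) - (x1 - x0).
  by rewrite opprB addrA subrK addrC addKr.
exact: rpredB.
Qed.

Lemma facet_row F : is_facet Q F -> exists i,
  (exists y, Q y /\ 0 < slack_map A b y i 0) /\
  F = [set x | Q x /\ slack_map A b x i 0 = 0].
Proof.
move=> [[c [dl [cQ FE]]] [k [[x0 [U [dU aQ]]] [x1 [W [dW aF]]]]]].
have FQ : F `<=` Q by rewrite FE => x [].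
have F0 : F !=set0.
  by apply: (@aff_hull_nonempty F x1); rewrite aF/= subrr mem0v.
have WU : (W <= U)%VS.
  by apply: (@direction_sub U W x0 x1); rewrite -aQ -aF; apply: aff_hull_mono.
pose g x := dl - (c *m x) 0 0.
have ag : affine_form g by exists c, dl.
have gF x : F x -> g x = 0 by rewrite FE /g => -[_ ->]; rewrite subrr.
have gQ x : Q x -> 0 <= g x by move=> /cQ; rewrite subr_ge0.
have Fg x : Q x -> g x = 0 -> F x.
  by move=> Qx /eqP; rewrite /g subr_eq0 FE => /eqP ->.
pose s := [seq i <- enum 'I_m | `[< exists y, F y /\ 0 < slack_map A b y i 0 >]].
have [xs [Fxs xs0]] : exists x, F x /\ forall i, i \in s -> 0 < slack_map A b x i 0.
  apply: (@exists_common_positive F _ s (fun i => h i)).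
  - exact: affine_form_slack.
  - exact: F0.
  - move=> x y Fx Fy; apply: Fg; first by apply: polyhedron_midpoint; exact: FQ.
    by rewrite affine_form_line// !gF//; ring.
  - by move=> i x _ /FQ /polyhedronP.
  - by move=> i; rewrite mem_filter => /andP[/asboolP].
have sN i : i \notin s -> forall x, F x -> slack_map A b x i 0 = 0.
  rewrite mem_filter mem_enum andbT => /asboolP/forallNP ins x Fx.
  have := FQ _ Fx => /polyhedronP /(_ i); rewrite le0r => /predU1P[//|xi].
  by case: (ins x).
have [i [iF [y [Qy yi]]]] : exists i, (forall x, F x -> slack_map A b x i 0 = 0) /\
    exists y, Q y /\ 0 < slack_map A b y i 0.
  apply: contrapT => /forallNP tight.
  have tightQ i : i \notin s -> forall y, Q y -> slack_map A b y i 0 = 0.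
    move=> /sN iF y Qy; have /not_andP[//|/forallNP/(_ y)/not_andP[//|/negP]] := tight i.
    by rewrite -leNgt => ?; apply/eqP; rewrite eq_le (polyhedronP y).1// andbT.
  have [y [Qy gy]] : exists y, Q y /\ 0 < g y.
    apply: contrapT => /forallNP gy; suff FQE : F = Q.
      have UW : (U <= W)%VS.
        by apply: (@direction_sub W U x1 x0); rewrite -aQ -aF FQE.
      by have := dimvS UW; rewrite dU dW ltnn.
    apply/seteqP; split=> // y Qy; apply: Fg => //.
    have /not_andP[//|/negP] := gy y; rewrite -leNgt => ?.
    by apply/eqP; rewrite eq_le gQ// andbT.
  have [eps [eps0 epsH]] := @exists_small_step _ s (fun i => slack_map A b xs i 0)
    (fun i => slack_map A b xs i 0 - slack_map A b y i 0) xs0.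
  have : Q (xs + (- eps) *: (y - xs)).
    apply/polyhedronP => i; rewrite (affine_form_line _ _ _ (affine_form_slack i)).
    rewrite mulNr -mulrN opprB.
    have [/epsH//|ns] := boolP (i \in s).
    by rewrite !(tightQ i ns)// ?subrr ?mulr0 ?addr0//; apply: FQ.
  by move=> /gQ; rewrite affine_form_line// (gF xs)//; nra.
exists i; split; first by exists y.
apply/seteqP; split=> [x Fx|z [Qz zi]]; first by split; [apply: FQ|apply: iF].
apply: contrapT => nFz.
have aff_xs w : w \in W -> aff_hull F (xs + w).
  move=> wW; rewrite aF/= addrAC rpredD//.
  by have := @sub_aff_hull _ _ F _ Fxs; rewrite aF.
have zW : z - xs \notin W.
  apply/negP => /aff_xs; rewrite addrC subrK => aFz; apply: nFz.
  apply: Fg => //; exact: affine_form_aff_hull aFz.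
have inU x : Q x -> x - xs \in U.
  move=> Qx; rewrite -[x](subrK x0) -addrA rpredD//.
    by have := @sub_aff_hull _ _ Q _ Qx; rewrite aQ.
  rewrite -opprB rpredN.
  by have := @sub_aff_hull _ _ Q _ (FQ _ Fxs); rewrite aQ.
have UE : U = (W + <[z - xs]>)%VS.
  apply/eqP; rewrite eq_sym eqEdim subv_add WU -memvE inU//= dU -dW.
  rewrite ltn_neqAle dimvS ?addvSl// andbT; apply: contra zW => /eqP dimE.
  have /eqP -> : W == (W + <[z - xs]>)%VS by rewrite eqEdim addvSl dimE/=.
  by apply: (subvP (addvSr _ _)); apply: memv_line.
have := inU _ Qy; rewrite UE => /memv_addP[w wW [_ /vlineP[t ->] /eqP]].
rewrite subr_eq => /eqP yE.
have ai := affine_form_slack i.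
move: yi; rewrite yE addrC addrA.
rewrite (affine_form_scale _ _ _ ai) (affine_form_sub _ _ ai).
rewrite zi (iF _ Fxs) subrr mulr0 addr0.
by rewrite (affine_form_aff_hull ai iF (aff_xs _ wW)) ltxx.
Qed.

End Polyhedron.

Section IrredundantRows.
Variables (R : realType) (e m : nat) (A : 'M[R]_(m, e)) (b : 'cV[R]_m).
Variables (x0 : 'cV[R]_e) (U : {vspace 'cV[R]_e}).
Implicit Types (x y z u : 'cV[R]_e) (J : {set 'I_m}).

Local Notation Q := (polyhedron A b).
Local Notation h i := (fun x : 'cV[R]_e => slack_map A b x i 0).

Hypothesis aQ : aff_hull Q = [set x | x - x0 \in U].
Hypothesis Q0 : Q !=set0.

Definition row_generating J := forall g, affine_form g ->
  (forall x, Q x -> 0 <= g x) ->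
  exists (al : 'I_m -> R) (be : R), [/\ forall i, 0 <= al i, 0 <= be &
    forall x, x - x0 \in U -> g x = \sum_(i in J) al i * h i x + be].

Lemma polyhedron_direction x : Q x -> x - x0 \in U.
Proof. by move=> /(@sub_aff_hull _ _ Q); rewrite aQ. Qed.

Lemma direction_line x y t : x - x0 \in U -> y - x0 \in U ->
  x + t *: (y - x) - x0 \in U.
Proof.
move=> xU yU; rewrite addrAC rpredD// rpredZ//.
have -> : y - x = (y - x0) - (x - x0) by rewrite opprB addrA subrK.
exact: rpredB.
Qed.

Lemma row_mulmxE i x : (row i A *m x) 0 0 = (A *m x) i 0.
Proof. by rewrite -row_mul mxE. Qed.

Lemma row_generatingT : row_generating [set: 'I_m]%SET.
Proof.
move=> g ag g0.
have [|||al [be [al0 be0 gE]]] := @affine_farkas R e x0 U _ (enum 'I_m)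
  (fun i => h i) g (affine_form_slack A b) ag.
- exact: enum_uniq.
- have [x Qx] := Q0; exists x; split; first exact: polyhedron_direction.
  by move=> i _; apply: (polyhedronP _ _ _).1.
- move=> x _ hx; apply/g0/polyhedronP => i; apply: hx.
  by rewrite mem_enum.
exists al, be; split=> // x xU.
by rewrite gE// big_enum; congr +%R; apply: eq_bigl => i; rewrite finset.in_setT.
Qed.

Lemma row_generating_polyhedron J x : row_generating J ->
  x - x0 \in U -> (forall i, i \in J -> 0 <= h i x) -> Q x.
Proof.
move=> genJ xU hx; apply/polyhedronP => i.
have [al [be [al0 be0 gE]]] := genJ (h i) (affine_form_slack A b i)
  (fun y Qy => (polyhedronP A b y).1 Qy i).
by rewrite gE// addr_ge0// sumr_ge0// => j jJ; rewrite mulr_ge0// hx.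
Qed.

Lemma irredundant_row J j : row_generating J ->
  (forall J', row_generating J' -> J' \subset J -> J' = J) -> j \in J ->
  exists x, [/\ x - x0 \in U, h j x < 0 &
    forall i, i \in J -> i != j -> 0 <= h i x].
Proof.
move=> genJ minJ jJ; apply: contrapT => nx.
have [|||al [be [al0 be0 jE]]] := @affine_farkas R e x0 U _ (enum (J :\ j))
  (fun i => h i) (h j) (affine_form_slack A b) (affine_form_slack A b j).
- exact: enum_uniq.
- have [x Qx] := Q0; exists x; split; first exact: polyhedron_direction.
  by move=> i _; apply: (polyhedronP _ _ _).1.
- move=> x xU hx; rewrite leNgt; apply/negP => hjx; apply: nx.
  exists x; split=> // i iJ ij; apply: hx.
  by rewrite mem_enum !inE ij.
have genJj : row_generating (J :\ j).
  move=> g ag g0; have [al' [be' [al'0 be'0 gE]]] := genJ g ag g0.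
  exists (fun i => al' j * al i + al' i), (al' j * be + be'); split.
  - by move=> i; rewrite addr_ge0// mulr_ge0.
  - by rewrite addr_ge0// mulr_ge0.
  - move=> x xU; rewrite gE// (big_setD1 j)//= jE// big_enum.
    have -> : \sum_(i in J :\ j) (al' j * al i + al' i) * h i x =
        al' j * \sum_(i in J :\ j) al i * h i x + \sum_(i in J :\ j) al' i * h i x.
      by rewrite mulr_sumr -big_split; apply: eq_bigr => i _ /=; ring.
    by ring.
have := minJ _ genJj (subsetDl _ _) => /setP/(_ j).
by rewrite !inE eqxx jJ.
Qed.

Lemma irredundant_facet J j z q : row_generating J -> j \in J ->
  Q z -> h j z = 0 -> (forall i, i \in J -> i != j -> 0 < h i z) ->
  Q q -> 0 < h j q ->
  is_facet Q [set x | Q x /\ h j x = 0].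
Proof.
move=> genJ jJ Qz hjz hz Qq hjq.
have aj := affine_form_slack A b j.
split.
  exists (row j A), (b j 0); split=> [x Qx|].
    by rewrite row_mulmxE.
  apply/seteqP; split=> x /= [Qx]; rewrite slack_mapE row_mulmxE.
    by move=> /eqP; rewrite subr_eq0 => /eqP ->.
  by move=> ->; rewrite subrr.
pose phi : 'Hom('cV[R]_e, 'M[R]_(1, 1)) := linfun (mulmx (row j A)).
have phiE u : phi u 0 0 = h j 0 - h j u.
  rewrite lfunE/= row_mulmxE !slack_mapE mulmx0 [X in _ - X - _]mxE.
  by ring.
have kerE u : (u \in lker phi) = (h j u - h j 0 == 0).
  rewrite memv_ker -[X in _ = (X == 0)]opprB -phiE oppr_eq0; apply/eqP/eqP => [->|phi0].
    by rewrite mxE.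
  by apply/matrixP => a c; rewrite !ord1 phi0 mxE.
have qz : q - z \in U.
  have -> : q - z = (q - x0) - (z - x0) by rewrite opprB addrA subrK.
  by rewrite rpredB// polyhedron_direction.
exists (\dim (U :&: lker phi)%VS); split.
  exists x0, U; split=> //; rewrite -(limg_ker_dim phi U).
  suff -> : \dim (phi @: U)%VS = 1%N by rewrite addn1.
  apply/eqP; rewrite eqn_leq (leq_trans (dimvS (subvf _)))/=; last first.
    by rewrite dimvf /dim/= muln1.
  rewrite lt0n dimv_eq0; apply/eqP => phiU0.
  have := memv_img phi qz; rewrite phiU0 memv0 => /eqP/matrixP/(_ 0 0).
  rewrite phiE [RHS]mxE => /eqP; rewrite -[X in X == 0]opprB oppr_eq0.
  rewrite (affine_form_sub _ _ aj) hjz subr0.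
  by rewrite gt_eqF.
exists z, (U :&: lker phi)%VS; split=> //; apply/seteqP; split=> x.
  move=> ax; have hjx : h j x = 0.
    by apply: (affine_form_aff_hull aj _ ax) => y [].
  have xU : x - x0 \in U.
    suff: aff_hull Q x by rewrite aQ.
    by apply: aff_hull_mono ax => y [].
  rewrite /= memv_cap kerE (affine_form_sub _ _ aj) hjx hjz subrr eqxx andbT.
  have -> : x - z = (x - x0) - (z - x0) by rewrite opprB addrA subrK.
  by rewrite rpredB// polyhedron_direction.
rewrite /= memv_cap kerE (affine_form_sub _ _ aj) hjz subr0 => /andP[xzU /eqP hjx].
have [|eps [eps0 epsH]] := @exists_small_step R _ (enum (J :\ j))
    (fun i => h i z) (fun i => h i x - h i z).
  by move=> i; rewrite mem_enum !inE => /andP[ij iJ]; apply: hz.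
pose y := z + eps *: (x - z).
have hjy : h j y = 0 by rewrite /y (affine_form_line _ _ _ aj) hjz hjx; ring.
have Qy : Q y.
  apply: (row_generating_polyhedron genJ).
    by rewrite /y addrAC rpredD ?rpredZ// polyhedron_direction.
  move=> i iJ; have [->|ij] := eqVneq i j; first by rewrite hjy.
  rewrite /y (affine_form_line _ _ _ (affine_form_slack A b i)).
  by apply: epsH; rewrite mem_enum !inE ij.
have -> : x = z + eps^-1 *: (y - z).
  by rewrite /y addrAC subrr add0r scalerA mulVf ?gt_eqF// scale1r addrC subrK.
by apply: aff_hull_cons => //; apply: sub_aff_hull.
Qed.

Lemma row_generating_cst J : row_generating J -> bounded_cV Q ->
  (exists p q, [/\ Q p, Q q & p != q]) ->
  exists be : 'I_m -> R, (forall i, 0 <= be i) /\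
    forall x, x - x0 \in U -> 1 = \sum_(i in J) be i * h i x.
Proof.
move=> genJ [B QB] [p [q [Qp Qq pq]]].
have [|||be [be0 beE]] := @affine_farkas_infeasible R e x0 U _ (enum J)
    (fun i x => - h i x).
- move=> i; exists (- row i A), (- b i 0) => x.
  by rewrite slack_mapE mulNmx [in RHS]mxE row_mulmxE; ring.
- exact: enum_uniq.
- move=> y yU hy.
  have [x [Qx xy]] : exists x, Q x /\ x != y.
    by have [<-|] := eqVneq p y; [exists q; rewrite eq_sym|exists p].
  (* All slacks in [J] being nonpositive at [y], the ray from [x] away from [y]
     stays in [Q]. *)
  have ray t : 0 <= t -> Q (x + (- t) *: (y - x)).
    move=> t0; apply: (row_generating_polyhedron genJ).
      by apply: direction_line => //; apply: polyhedron_direction.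
    move=> i iJ; rewrite (affine_form_line _ _ _ (affine_form_slack A b i)).
    have := hy i; rewrite mem_enum => /(_ iJ).
    have := (polyhedronP A b x).1 Qx i; nra.
  have [i xyi] : exists i, x i 0 != y i 0.
    apply: contrapT => /forallNP xyE; move/eqP: xy; apply; apply/colP => i.
    by have /negP/negPn/eqP := xyE i.
  have yx0 : 0 < `|y i 0 - x i 0| by rewrite normr_gt0 subr_eq0 eq_sym.
  have B0 : 0 <= B by apply: le_trans (QB _ Qx i).
  pose t := (B + B + 1) / `|y i 0 - x i 0|.
  have t0 : 0 <= t by rewrite divr_ge0// ltW//; lra.
  have := QB _ (ray t t0) i; rewrite !mxE.
  have := QB _ Qx i; have tE : `|- t * (y i 0 - x i 0)| = B + B + 1.
    by rewrite normrM normrN (ger0_norm t0) /t divfK// gt_eqF.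
  have := ler_normB (x i 0 + - t * (y i 0 - x i 0)) (x i 0).
  by rewrite addrAC subrr add0r tE; lra.
exists be; split=> // x xU; apply: oppr_inj; rewrite (beE x xU) big_enum.
by rewrite -sumrN; apply: eq_bigr => i _; rewrite mulrN.
Qed.

End IrredundantRows.

Section FacetCount.
Variables (R : realType) (e m : nat) (A : 'M[R]_(m, e)) (b : 'cV[R]_m).

Local Notation Q := (polyhedron A b).
Local Notation h i := (fun x : 'cV[R]_e => slack_map A b x i 0).

Lemma facets_le r (f : 'I_r -> 'I_m) :
  (forall i y, Q y -> 0 < h i y -> exists k, i = f k) ->
  exists n, (n <= r)%N /\ (facets Q #= `I_n)%card.
Proof.
move=> fP; pose G k := [set x | Q x /\ h (f k) x = 0].
have sub : facets Q `<=` G @` [set: 'I_r].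
  by move=> F /facet_row[i [[y [Qy /(fP _ _ Qy)[k ->]]] ->]]; exists k.
have le : (facets Q #<= `I_r)%card.
  rewrite (card_le_eqr card_II); apply: card_le_trans (card_image_le G _).
  exact: subset_card_le.
have [n Fn] : exists n, (facets Q #= `I_n)%card.
  by apply/finite_setP/finite_set_leP; exists r.
by exists n; split=> //; rewrite -card_le_II -(card_le_eql Fn).
Qed.

Lemma exists_facet_generators :
  bounded_cV Q -> (exists p q, [/\ Q p, Q q & p != q]) ->
  exists J : {set 'I_m},
    (forall n, (facets Q #= `I_n)%card -> (#|J| <= n)%N) /\
    forall g, affine_form g -> (forall x, Q x -> 0 <= g x) ->
      exists al : 'I_m -> R, (forall i, 0 <= al i) /\
        forall x, Q x -> g x = \sum_(i in J) al i * h i x.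
Proof.
move=> bQ dQ; have Q0 : Q !=set0 by have [p [_ [Qp _ _]]] := dQ; exists p.
have [x0 Qx0] := Q0; have [U aQ] := aff_hull_vspace Qx0.
have QU := polyhedron_direction aQ.
have [J /minsetP[/asboolP genJ minJ]] :
    {J | minset (fun J => `[< row_generating A b x0 U J >]) J}.
  by apply: ex_minset; exists [set: 'I_m]%SET; apply/asboolP/row_generatingT.
have irr := @irredundant_row _ _ _ _ _ _ _ aQ Q0 _ _ genJ _.
exists J; split=> [n Fn|g ag g0]; last first.
  have [be [be0 beE]] := row_generating_cst aQ genJ bQ dQ.
  have [al [c [al0 c0 gE]]] := genJ _ ag g0.
  exists (fun i => al i + c * be i); split=> [i|x /QU xU].
    by rewrite addr_ge0// mulr_ge0.
  rewrite gE// -[c in LHS]mulr1 (beE _ xU) mulr_sumr -big_split.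
  by apply: eq_bigr => i _ /=; ring.
have {}irr j : j \in J -> exists x, [/\ x - x0 \in U, h j x < 0 &
    forall i, i \in J -> i != j -> 0 <= h i x].
  apply: irr => J' genJ' JJ'; apply: minJ => //; exact/asboolP.
have [q [Qq hq]] : exists q, Q q /\ forall j, j \in enum J -> 0 < h j q.
  apply: (@exists_common_positive _ _ Q _ _ (fun i => h i)) => //.
  - exact: affine_form_slack.
  - exact: polyhedron_midpoint.
  - by move=> i x _ /polyhedronP; apply.
  move=> j; rewrite mem_enum => /irr[x [xU hjx _]].
  apply: contrapT => /forallNP nhj.
  suff : h j x = 0 by move=> hj0; rewrite hj0 ltxx in hjx.
  apply: (affine_form_aff_hull (affine_form_slack A b j) _ (S := Q)).
    move=> y Qy; have /not_andP[//|/negP] := nhj y; rewrite -leNgt => hjy.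
    by apply/eqP; rewrite eq_le hjy (polyhedronP A b y).1.
  by rewrite aQ.
have {}hq j : j \in J -> 0 < h j q by rewrite -mem_enum; apply: hq.
have zP j : j \in J -> exists z, [/\ Q z, h j z = 0 &
    forall i, i \in J -> i != j -> 0 < h i z].
  move=> jJ; have [x [xU hjx hx]] := irr j jJ; have hjq := hq _ jJ.
  pose t := h j q / (h j q - h j x).
  have D0 : 0 < h j q - h j x by lra.
  have t0 : 0 < t by rewrite divr_gt0.
  have t1 : t < 1 by rewrite ltr_pdivrMr// mul1r; lra.
  pose z := q + t *: (x - q).
  have hz i : h i z = h i q + t * (h i x - h i q).
    by rewrite /z (affine_form_line _ _ _ (affine_form_slack A b i)).
  have hjz : h j z = 0 by rewrite hz /t; field; rewrite gt_eqF.
  have hiz i : i \in J -> i != j -> 0 < h i z.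
    by move=> iJ ij; rewrite hz; have := hx i iJ ij; have := hq _ iJ; nra.
  exists z; split=> //; apply: (row_generating_polyhedron genJ) => [|i iJ].
    by apply: direction_line => //; apply: QU.
  by have [->|ij] := eqVneq i j; [rewrite hjz | apply/ltW/hiz].
pose G j := [set x | Q x /\ h j x = 0].
have injG : {in [set` J] &, injective G}.
  move=> i j; rewrite !inE => iJ jJ /seteqP[_ GE].
  apply: contrapT => /eqP ij; have [z [Qz hz hiz]] := zP _ jJ.
  by have [_] := GE z (conj Qz hz) => h0; have := hiz i iJ ij; rewrite h0 ltxx.
have GF : G @` [set` J] `<=` facets Q.
  move=> _ [j /= jJ <-]; have [z [Qz hjz hz]] := zP _ jJ.
  by apply: (irredundant_facet aQ genJ jJ Qz hjz hz Qq); apply: hq.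
rewrite -card_le_II -(card_le_eqr Fn).
apply: card_le_trans (subset_card_le GF).
rewrite (card_le_eqr (inj_card_eq injG)).
have/card_eq_fsetP JE : #|` [fset i | i in J]%fset| = #|J|.
  by rewrite card_imfset//= -cardE.
rewrite -(card_le_eql JE); apply: subset_card_le => i /=.
by rewrite in_fset.
Qed.

End FacetCount.

Section Extensions.
Variable R : realType.

Lemma slack_set_of_extension d m (A : 'M[R]_(m, d)) (b : 'cV[R]_m) e
    (Q : set 'cV[R]_e) f n :
  is_extension (polyhedron A b) Q f ->
  (exists p q, [/\ polyhedron A b p, polyhedron A b q & p != q]) ->
  (facets Q #= `I_n)%card ->
  exists T : {fset 'cV[R]_m}, is_slack_generating_set A b T /\ (#|` T|%fset <= n)%N.
Proof.
move=> [[[mq [AQ [bQ QE]]] QB] [M [c fE]] fQ] [p [q [Pp Pq pq]]] Fn.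
rewrite {}QE in QB fQ Fn.
have [|J [Jn Jgen]] := @exists_facet_generators R e mq AQ bQ QB.
  move: Pp Pq pq; rewrite -fQ => -[p' Qp' <-] [q' Qq' <-] pq.
  by exists p', q'; split=> //; apply: contra_neq pq => ->.
pose g i y := slack_map A b (f y) i 0.
have ag i : affine_form (g i).
  exists (row i (A *m M)), (b i 0 - (A *m c) i 0) => y.
  rewrite row_mulmxE /g slack_mapE fE mulmxDr mulmxA [X in _ - X = _]mxE.
  by ring.
have g0 i y : polyhedron AQ bQ y -> 0 <= g i y.
  by move=> Qy; apply: (polyhedronP A b (f y)).1; rewrite -fQ; exists y.
have /choice[al alP] i := Jgen (g i) (ag i) (g0 i).
pose t j : 'cV[R]_m := \col_i al i j.
have tE i j : t j i 0 = al i j by rewrite mxE.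
exists [fset t j | j in J]%fset; split; last first.
  by apply: leq_trans (Jn _ Fn); rewrite cardE leq_imfset_card.
split=> [_ /imfsetP[j /= jJ ->] i|s [x Px <-]].
  by rewrite tE (alP i).1.
move: Px; rewrite -fQ => -[y Qy <-].
pose h j := slack_map AQ bQ y j 0.
exists (fun u => \sum_(j in J | t j == u) h j); split=> [u _|].
  by rewrite sumr_ge0// => j _; apply: (polyhedronP AQ bQ y).1.
under eq_bigr do rewrite scaler_suml big_mkcondr/=.
rewrite exchange_big/=; transitivity (\sum_(j in J) h j *: t j).
  apply/colP => i; rewrite summxE -/(g i y) (alP i).2//.
  by apply: eq_bigr => j _; rewrite [RHS]mxE tE mulrC.
apply: eq_bigr => j jJ; rewrite -big_mkcond/=.
under eq_bigl do rewrite eq_sym.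
by rewrite -big_filter filter_pred1_uniq ?big_seq1 ?fset_uniq//; apply/imfsetP; exists j.
Qed.

Lemma bounded_slack d m (A : 'M[R]_(m, d)) (b : 'cV[R]_m) (S : set 'cV[R]_d) :
  bounded_cV S -> exists C : 'I_m -> R, forall x, S x ->
    forall i, slack_map A b x i 0 <= C i.
Proof.
move=> [B SB]; exists (fun i => b i 0 + \sum_j `|A i j| * B) => x Sx i.
rewrite slack_mapE lerD2l mxE -sumrN; apply: ler_sum => j _.
rewrite (le_trans (ler_norm _))// normrN normrM ler_wpM2l//.
exact: SB.
Qed.

Lemma extension_of_slack_set d m (A : 'M[R]_(m, d)) (b : 'cV[R]_m)
    (T : {fset 'cV[R]_m}) :
  bounded_cV (polyhedron A b) -> is_slack_generating_set A b T ->
  exists n, (n <= #|` T|%fset)%N /\ extension_sizes (polyhedron A b) n.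
Proof.
move=> PB [T0 Tgen].
(* A zero generator would leave its coefficient unbounded in the extension. *)
pose s := [seq t <- T | t != 0]; pose r := size s.
pose N : 'M[R]_(m, r) := \matrix_(i, k) (s`_k i 0).
have sT k : (k < r)%N -> s`_k \in T /\ s`_k != 0.
  by move=> kr; have := mem_nth 0 kr; rewrite mem_filter => /andP[].
have N0 i k : 0 <= N i k by rewrite mxE T0//; apply: (sT k _).1.
pose AQ : 'M[R]_(m + m + r, d + r) :=
  col_mx (col_mx (row_mx A N) (- row_mx A N)) (row_mx 0 (- 1%:M)).
pose bQ : 'cV[R]_(m + m + r) := col_mx (col_mx b (- b)) 0.
have AQE x l : AQ *m col_mx x l =
    col_mx (col_mx (A *m x + N *m l) (- (A *m x + N *m l))) (- l).
  by rewrite !mul_col_mx mulNmx !mul_row_col mul0mx add0r mulNmx mul1mx.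
have QE x l : polyhedron AQ bQ (col_mx x l) <->
    N *m l = slack_map A b x /\ forall k, 0 <= l k 0.
  rewrite /polyhedron/= AQE; split=> [H|[lE l0] i].
    split=> [|k]; last first.
      by have := H (rshift _ k); rewrite !col_mxEd !mxE oppr_le0.
    apply/colP => i; rewrite slack_mapE.
    have := H (lshift _ (lshift _ i)); rewrite !col_mxEu mxE => h1.
    have := H (lshift _ (rshift _ i)); rewrite !(col_mxEu, col_mxEd).
    rewrite mxE [X in - X]mxE [X in _ <= X]mxE => h2.
    lra.
  case: (split_ordP i) => [{}i ->|k ->]; last first.
    by rewrite !col_mxEd !mxE oppr_le0.
  rewrite !col_mxEu lE /slack_map addrC subrK.
  by case: (split_ordP i) => {}i ->; rewrite ?col_mxEu ?col_mxEd.
have [n [nr Fn]] : exists n, (n <= r)%N /\ (facets (polyhedron AQ bQ) #= `I_n)%card.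
  apply: (@facets_le _ _ _ _ _ _ (fun k => rshift (m + m) k)) => i y.
  case: (split_ordP i) => [{}i ->|k ->]; last by exists k.
  rewrite -[y]vsubmxK => /QE[lE _]; rewrite slack_mapE AQE !col_mxEu lE.
  rewrite /slack_map [A *m _ + _]addrC subrK.
  by case: (split_ordP i) => {}i ->; rewrite ?col_mxEu ?col_mxEd subrr ltxx.
exists n; split.
  by rewrite (leq_trans nr)// /r size_filter count_size.
exists (d + r)%N, (polyhedron AQ bQ), (fun y => usubmx y); split=> //; split.
- split; first by exists (m + m + r)%N, AQ, bQ.
  have [C PC] := bounded_slack A b PB; have {PB} [B PB] := PB.
  have /choice[i0 i0P] : forall k : 'I_r, exists i, 0 < N i k.
    move=> k; apply: contrapT => /forallNP Nk.
    have [_ /eqP] := sT k (ltn_ord k); apply; apply/colP => i.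
    have /negP := Nk i; rewrite -leNgt => Nik.
    by apply/eqP; have := N0 i k; move: Nik; rewrite !mxE eq_le => -> ->.
  exists (`|B| + \sum_k `|C (i0 k) / N (i0 k) k|) => y.
  rewrite -[y]vsubmxK => /QE[lE l0].
  set x := usubmx y in lE *; set l := dsubmx y in lE l0 *.
  have Px : polyhedron A b x.
    apply/polyhedronP => i; rewrite -lE mxE sumr_ge0// => k _.
    by rewrite mulr_ge0.
  have Bx j : `|x j 0| <= `|B| by apply: le_trans (PB _ Px j) (ler_norm _).
  move=> i; case: (split_ordP i) => [j ->|k ->].
    by rewrite col_mxEu (le_trans (Bx j))// lerDl sumr_ge0.
  rewrite col_mxEd ger0_norm// (bigD1 k)//= addrCA.
  rewrite (@le_trans _ _ (C (i0 k) / N (i0 k) k))//; last first.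
    by rewrite (le_trans (ler_norm _))// lerDl addr_ge0// sumr_ge0.
  rewrite ler_pdivlMr// (le_trans _ (PC _ Px (i0 k)))// -lE [leRHS]mxE.
  by rewrite (bigD1 k)//= mulrC lerDl sumr_ge0// => k' _; rewrite mulr_ge0.
- exists (row_mx 1%:M 0), 0 => y.
  by rewrite -[in RHS](vsubmxK y) mul_row_col mul1mx mul0mx !addr0.
apply/seteqP; split=> [_ [y Qy <-]|x Px].
  move: Qy; rewrite -[y]vsubmxK => /QE[lE l0]; apply/polyhedronP => i.
  by rewrite col_mxKu -lE mxE sumr_ge0// => k _; rewrite mulr_ge0.
have [l [l0 lE]] := Tgen (slack_map A b x) (imageP _ Px).
exists (col_mx x (\col_(k < r) l s`_k)); last by rewrite col_mxKu.
apply/QE; split=> [|k]; last by rewrite mxE l0//; apply: (sT k _).1.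
rewrite lE; have -> : \sum_(t <- T) l t *: t = \sum_(t <- s) l t *: t.
  rewrite big_filter [RHS]big_mkcond/=; apply: eq_bigr => t _.
  by case: eqP => //= ->; rewrite scaler0.
apply/colP => i; rewrite mxE summxE (big_nth 0) big_mkord.
by apply: eq_bigr => k _; rewrite !mxE mulrC.
Qed.

Lemma exists_minimum (S : set nat) : S !=set0 -> exists n, is_minimum S n.
Proof.
move=> [k Sk]; have ex : exists n, `[< S n >] by exists k; apply/asboolP.
case: (ex_minnP ex) => n /asboolP Sn minn.
by exists n; split=> // j Sj; apply: minn; apply/asboolP.
Qed.

Lemma has_dim_two_points d (S : set 'cV[R]_d) k : (1 <= k)%N -> has_dim S k ->
  exists p q, [/\ S p, S q & p != q].
Proof.
move=> k1 [x0 [U [dU aS]]]; apply: contrapT => nS.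
have [p Sp] : S !=set0.
  by apply: (@aff_hull_nonempty _ _ _ x0); rewrite aS/= subrr mem0v.
have pE x : S x -> x = p.
  by move=> Sx; apply: contrapT => /eqP xp; apply: nS; exists x, p.
have ap x : aff_hull S x -> x = p.
  move=> [n [z [l [Sz l1 ->]]]]; under eq_bigr do rewrite (pE _ (Sz _)).
  by rewrite -scaler_suml l1 scale1r.
suff U0 : U = 0%VS by rewrite -dU U0 dimv0 in k1.
apply/eqP; rewrite -subv0; apply/subvP => u uU; rewrite memv0.
have /ap x0p : aff_hull S x0 by rewrite aS/= subrr mem0v.
have /ap : aff_hull S (x0 + u) by rewrite aS/= addrC addKr.
by rewrite -x0p => /(canRL (addKr x0)) ->; rewrite addNr.
Qed.

Lemma xc_min_slack_size d m (A : 'M[R]_(m, d)) (b : 'cV[R]_m) n :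
  bounded_cV (polyhedron A b) ->
  (exists p q, [/\ polyhedron A b p, polyhedron A b q & p != q]) ->
  is_xc (polyhedron A b) n -> is_min_slack_size A b n.
Proof.
move=> PB pq [[e [Q [f [ext Fn]]]] minn].
have [T [gT Tn]] := slack_set_of_extension ext pq Fn.
have lb : lbound (slack_generating_set_sizes A b) n.
  move=> _ [T' [gT' <-]]; have [n' [le ext']] := extension_of_slack_set PB gT'.
  exact: leq_trans (minn _ ext') le.
split=> //; exists T; split=> //; apply/eqP; rewrite eqn_leq Tn.
by apply: lb; exists T.
Qed.

End Extensions.

Theorem theorem2p5 (R : realType) (d m : nat) (A : 'M[R]_(m, d))
    (b : 'cV[R]_m) (hP : is_polytope (polyhedron A b))
    (hdim : exists k : nat, (1 <= k)%N /\ has_dim (polyhedron A b) k) :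
  exists r : nat,
    is_xc (polyhedron A b) r /\
    is_min_slack_size A b r /\
    (forall (m' : nat) (A' : 'M[R]_(m', d)) (b' : 'cV[R]_m'),
       polyhedron A' b' = polyhedron A b -> is_min_slack_size A' b' r).
Proof.
have [k [k1 dimP]] := hdim; have pq := has_dim_two_points k1 dimP.
have [_ PB] := hP.
have [r xcr] : exists r, is_xc (polyhedron A b) r.
  have [n [_ Fn]] := @facets_le R d m A b m id (fun i _ _ _ => ex_intro _ i erefl).
  apply: exists_minimum; exists n, d, (polyhedron A b), id; split=> //.
  split=> //; last by rewrite image_id.
  by exists 1%:M, 0 => y; rewrite mul1mx addr0.
exists r; split=> //; split; first exact: xc_min_slack_size.
by move=> m' A' b' PE; apply: xc_min_slack_size; rewrite PE.
Qed.
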